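(* Let $\lambda$ and $\beta$ be positive random variables on a probability space $(\Omega,\mathcal F,\mathbb P)$ satisfying $$\mathbb E\left[\frac{\beta}{\lambda^{1/\beta}}\left(\frac{\beta+1}{\beta}\right)^{\frac{\beta+1}{\beta}}\right]<\infty,\qquad \mathbb E[\lambda]<\infty,\qquad \mathbb E[\lambda\beta]<\infty ,$$ and consider the Kies mixture with CDF $F(t)=\mathbb E[H(t;\lambda,\beta)]$. Let the positive random variable $\tau$ on $(\Omega,\mathcal F,\mathbb P)$ be such that $$\lambda=\tau\left(\frac{1}{\mathbb E[e^{-\tau}]}-1\right)^\beta$$ (almost surely). Then the saturation $d$ of the Kies mixture is $$d=\mathbb E\left[e^{-\tau}\right].$$
   Context: For constants $\lambda,\beta>0$ the Kies CDF is $H(t;\lambda,\beta)=1-\exp\left(-\lambda\left(\frac{t}{1-t}\right)^\beta\right)$ for $t\in[0,1)$, with $H(1;\lambda,\beta)=1$; for random $\lambda,\beta$ it is evaluated pointwise in $\omega$. Since $\tau$ is positive, $0<\mathbb E[e^{-\tau}]<1$. Equip $\mathbb R^2$ with the max-norm $\lVert(t_A,x_A)-(t_B,x_B)\rVert=\max\{|t_A-t_B|,|x_A-x_B|\}$. The Hausdorff distance between two curves $g,h\subset\mathbb R^2$ is $\max\left\{\sup_{A\in g}\inf_{B\in h}\lVert A-B\rVert,\ \sup_{B\in h}\inf_{A\in g}\lVert A-B\rVert\right\}$. The saturation of a distribution on $(0,1)$ with CDF $F$ is the Hausdorff distance between the completed graph of $F$ on $[0,1]$ (for continuous $F$, simply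 $\{(t,F(t)):t\in[0,1]\}$) and the curve consisting of the vertical segment from $(0,0)$ to $(0,1)$ and the horizontal segment from $(0,1)$ to $(1,1)$. *)

(* Defs.v *)
From mathcomp Require Import all_boot all_order all_algebra.
From mathcomp Require Import all_classical all_reals all_analysis.

Set Implicit Arguments.
Unset Strict Implicit.
Unset Printing Implicit Defensive.

Import Order.TTheory GRing.Theory Num.Theory.
Import numFieldNormedType.Exports.

Local Open Scope classical_set_scope.
Local Open Scope ring_scope.

(* Extended by 0 on t < 0 and by 1 on t >= 1, as a CDF on the whole line. *)
Definition kies_cdf (R : realType) (lambda beta t : R) : R :=
  if t < 0 then 0
  else if t < 1 then 1 - expR (- (lambda * (t / (1 - t)) `^ beta))
  else 1.

Definition kies_mixture_cdf (d : measure_display) (Omega : measurableType d)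
    (R : realType) (P : probability Omega R) (lambda beta : Omega -> R)
    (t : R) : R :=
  fine 'E_P[fun w => kies_cdf (lambda w) (beta w) t].

(* The library norm on R * R is the max-norm, cf. max_normE below. *)
Definition hausdorff_distance (R : realType) (g h : set (R * R)) : \bar R :=
  maxe
    (ereal_sup [set ereal_inf [set (`|A - B|)%:E | B in h] | A in g])
    (ereal_sup [set ereal_inf [set (`|A - B|)%:E | A in g] | B in h]).

Definition vertically_convex (R : realType) (C : set (R * R)) : Prop :=
  forall t y1 y2 y : R, C (t, y1) -> C (t, y2) -> y1 <= y <= y2 -> C (t, y).

Definition graph01 (R : realType) (F : R -> R) : set (R * R) :=
  [set (t, F t) | t in `[0, 1]].

(* Sendov's completed graph: the smallest closed set containing the graph over
   [0, 1] that is convex in the vertical direction. It fills the jumps of F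
   with vertical segments. *)
Definition completed_graph (R : realType) (F : R -> R) : set (R * R) :=
  \bigcap_(C in [set C : set (R * R) |
      [/\ closed C, vertically_convex C & graph01 F `<=` C]]) C.

Definition corner_curve (R : realType) : set (R * R) :=
  ([set 0] `*` `[0, 1]) `|` (`[0, 1] `*` [set 1]).

Definition saturation (R : realType) (F : R -> R) : \bar R :=
  hausdorff_distance (completed_graph F) (@corner_curve R).

Lemma max_normE (R : realType) (tA xA tB xB : R) :
  `|((tA, xA) : R * R) - (tB, xB)| = Num.max `|tA - tB| `|xA - xB|.
Proof. by []. Qed.

Lemma completed_graph_continuous (R : realType) (F : R -> R) :
  {within `[0, 1], continuous F} -> completed_graph F = graph01 F.
Proof.
move=> cF; apply/seteqP; split; last by move=> A gA C [_ _]; apply.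
move=> A /(_ (graph01 F)); apply; split => //.
- apply: compact_closed; first exact: (@norm_hausdorff R (R * R)%type).
  rewrite /graph01.
  apply: (@continuous_compact R (R * R)%type (fun t : R => (t, F t))); last first.
    exact: segment_compact.
  move=> t; have ct : {within `[0%R, 1%R], continuous (@id R)}.
    by apply: continuous_subspaceT => x; exact: cvg_id.
  exact: (cvg_pair (ct t) (cF t)).
- move=> t y1 y2 y [s1 s01 [s1t <-]] [s2 _ [s2t <-]].
  by rewrite s1t s2t => /le_anti <-; exists t; rewrite -?s1t.
Qed.

(* Main.v *)
(* Put d = E[exp(-tau)]. The relation between lambda and tau says exactly that
   H(d; lambda, beta) = 1 - exp(-tau), whence F(d) = 1 - d. As F is
   nondecreasing, its graph stays in the rectangles [0, d] x [0, 1 - d] and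
   [d, 1] x [1 - d, 1]; every point of these is within d of the corner curve,
   and none is closer than d to the corner (0, 1). Conversely, points (0, y)
   with y <= 1 - d are approached by solving F(s) = y on [0, d], points (t, 1)
   with t >= d by (t, F(t)), and all the others by (d, 1 - d). *)

Require Import Defs.
From mathcomp Require Import all_boot all_order all_algebra.
From mathcomp Require Import all_classical all_reals all_analysis.
From mathcomp Require Import measurable_realfun ring lra.
Import Order.TTheory GRing.Theory Num.Theory.
Import numFieldNormedType.Exports.
Local Open Scope classical_set_scope.
Local Open Scope ring_scope.

(** * Completed graphs and the saturation of a nondecreasing function *)

Lemma closed_setX (T U : topologicalType) (A : set T) (B : set U) :
  closed A -> closed B -> closed (A `*` B).
Proof.
move=> cA cB; apply: (@closedI _ (fst @^-1` A) (snd @^-1` B)).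
- by apply: preimage_closed => // x _; exact: cvg_fst.
- by apply: preimage_closed => // x _; exact: cvg_snd.
Qed.

(** The union of the two rectangles is one of the closed, vertically convex sets that the completed
    graph intersects. Monotonicity and the value at [d] put the graph inside it. *)
Lemma completed_graph_sub (R : realType) (F : R -> R) (d : R) :
  0 <= d <= 1 -> {in `[0, 1] &, {homo F : x y / x <= y}} ->
  F 0 = 0 -> F 1 = 1 -> F d = 1 - d ->
  completed_graph F `<=`
    (`[0, d] `*` `[0, 1 - d]) `|` (`[d, 1] `*` `[1 - d, 1]).
Proof.
move=> /andP[d0 d1] ndF F0 F1 Fd; apply: bigcap_inf; split.
- by apply: closedU; apply: closed_setX; exact: interval_closed.
(* The rectangles share only the abscissa [t = d], where their vertical sides meet at height [1 - d]
   and together fill [[0, 1]]. *)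
- move=> t y1 y2 y [] [] /=; rewrite !in_itv/= => t1 y1P [] [] /= t2 y2P y12;
    have [yd|yd] := lerP y (1 - d);
    by [left; lra | right; lra].
- move=> _ [t /= /[!in_itv]/= /andP[t0 t1] <-].
  have I x : 0 <= x -> x <= 1 -> x \in `[0, 1] by rewrite in_itv/= => -> ->.
  have [td|/ltW dt] := leP t d; [left|right]; split.
  + by rewrite t0.
  + by rewrite -{1}F0 -Fd !ndF// I.
  + by rewrite dt.
  + by rewrite -{2}F1 -Fd !ndF// I.
Qed.

(** Continuity serves to attain every height up to [1 - d] on [[0, d]]. For [d < 1] this interval
    stays away from [t = 1], where [t / (1 - t)] is singular. *)
Lemma saturation_eq (R : realType) (F : R -> R) (d : R) :
  0 <= d <= 1 -> {in `[0, 1] &, {homo F : x y / x <= y}} ->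
  F 0 = 0 -> F 1 = 1 -> F d = 1 - d -> {within `[0, d], continuous F} ->
  saturation F = d%:E.
Proof.
move=> /[dup] d01 /andP[d0 d1] ndF F0 F1 Fd cF.
have Gsub := completed_graph_sub _ _ _ d01 ndF F0 F1 Fd.
have inG t : 0 <= t <= 1 -> completed_graph F (t, F t).
  by move=> t01 C [_ _]; apply; exists t; rewrite //= in_itv.
have normle (a b x y : R) :
    `|(a, x) - (b, y) : R * R| <= d = (`|a - b| <= d) && (`|x - y| <= d).
  by rewrite max_normE ge_max.
apply/le_anti/andP; split.
- rewrite ge_max; apply/andP; split; apply: ge_ereal_sup => _ [[t y] + <-].
  + move=> /Gsub[] [] /=; rewrite !in_itv/= => tP yP.
    (* A point of the lower rectangle moves horizontally to the vertical segment, over a distance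
       [t <= d]; one of the upper rectangle moves up to height 1, over [1 - y <= d]. *)
    * apply: ge_ereal_inf; exists (`|(t, y) - (0, y)|)%:E.
        by exists (0, y) => //; left; split; rewrite //= in_itv/=; lra.
      by rewrite lee_fin normle !ler_norml; lra.
    * apply: ge_ereal_inf; exists (`|(t, y) - (t, 1)|)%:E.
        by exists (t, 1) => //; right; split; rewrite //= in_itv/=; lra.
      by rewrite lee_fin normle !ler_norml; lra.
  (* In the max-norm it suffices to find one abscissa [s] whose graph point is within [d] of the
     target in each coordinate. *)
  + have close s : 0 <= s <= 1 -> `|s - t| <= d -> `|F s - y| <= d ->
        (ereal_inf [set (`|A - (t, y)|)%:E | A in completed_graph F] <= d%:E)%E.
      move=> s01 st sy; apply: ge_ereal_inf.
      exists (`|(s, F s) - (t, y)|)%:E.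
        by exists (s, F s) => //; exact: inG.
      by rewrite lee_fin normle st.
    case=> -[] /=.
    * move=> tE /[!in_itv]/= /andP[y0 y1]; subst t.
      have [yd|yd] := leP y (1 - d).
        have [|s /[!in_itv]/= /andP[s0 sd] Fs] := @IVT _ F 0 d y d0 cF.
          by rewrite F0 Fd ge_min le_max y0 yd orbT.
        by apply: (close s); rewrite ?Fs ?ler_norml; lra.
      by apply: (close d); rewrite ?Fd ?ler_norml; lra.
    * move=> /[!in_itv]/= /andP[t0 t1] yE; subst y.
      have [td|/ltW td] := leP t d.
        by apply: (close d); rewrite ?Fd ?ler_norml; lra.
      have Ftd : 1 - d <= F t by rewrite -Fd ndF ?in_itv/=; lra.
      have Ft1 : F t <= 1 by rewrite -[leRHS]F1 ndF ?in_itv/=; lra.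
      by apply: (close t); rewrite ?ler_norml; lra.
- rewrite le_max; apply/orP; right; apply: le_ereal_sup_tmp.
  exists (ereal_inf [set (`|A - (0, 1)|)%:E | A in completed_graph F]).
    by exists (0, 1) => //; left; split; rewrite //= in_itv/= ler01 lexx.
  apply: le_ereal_inf_tmp => _ [[t y] /Gsub tyC <-].
  rewrite lee_fin max_normE le_max !ler_normr.
  (* In the lower rectangle the height is at least [d] below 1; in the upper one the abscissa is at
     least [d]. *)
  by case: tyC => -[] /=; rewrite !in_itv/= => tP yP; apply/orP; [right|left];
    apply/orP; [right|left]; lra.
Qed.

(** * Continuity, monotonicity and special values of the Kies CDF *)

Lemma maxr0_powR_continuous (R : realType) (b : R) :
  0 < b -> continuous (fun x : R => Num.max x 0 `^ b).
Proof.
move=> b0 x; have [x0|x0] := leP x 0.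
- apply/cvgrPdist_lt => e e0; have eb0 : 0 < e `^ b^-1 by rewrite powR_gt0.
  near=> y; rewrite (max_idPr x0) powR0 ?gt_eqF// sub0r normrN.
  rewrite ger0_norm ?powR_ge0//.
  have -> : e = (e `^ b^-1) `^ b by rewrite -powRrM mulVf ?gt_eqF ?powRr1 ?ltW.
  rewrite gt0_ltr_powR ?nnegrE ?le_max ?lexx ?orbT ?(ltW eb0)//.
  rewrite gt_max eb0 andbT.
  suff : y \in `]-oo, e `^ b^-1[ by rewrite in_itv.
  by near: y; apply: near_in_itvNyo; rewrite in_itv/= (le_lt_trans x0).
(* At [x > 0] the truncation is locally the identity, so derivability of the power gives
   continuity. *)
- have x0y : x \in `]0, +oo[ by rewrite in_itv/= x0.
  have near0 : \forall y \near x, y `^ b = Num.max y 0 `^ b.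
    near=> y; rewrite max_l// ltW//.
    suff : y \in `]0, +oo[ by rewrite in_itv/= andbT.
    by near: y; exact: near_in_itvoy.
  rewrite /continuous_at -(nbhs_singleton near0).
  apply: cvg_trans (near_eq_cvg near0) _.
  suff : {for x, continuous (@powR R ^~ b)} by [].
  apply: differentiable_continuous; apply/derivable1_diffP.
  exact: derivable_powR.
Unshelve. all: by end_near. Qed.

Lemma kies_cdf_continuous (R : realType) (l b t : R) :
  0 < b -> t < 1 -> {for t, continuous (kies_cdf l b)}.
Proof.
move=> b0 t1.
pose f s : R := 1 - expR (- (l * Num.max (s / (1 - s)) 0 `^ b)).
have fE s : s < 1 -> f s = kies_cdf l b s.
  move=> s1; rewrite /f /kies_cdf s1; case: ltP => s0.
    rewrite (max_idPr _) ?powR0 ?gt_eqF ?mulr0 ?oppr0 ?expR0 ?subrr//.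
    by rewrite nmulr_rle0// invr_ge0 subr_ge0 ltW.
  by rewrite (max_idPl _)// divr_ge0// subr_ge0 ltW.
have near1 : \forall s \near t, f s = kies_cdf l b s.
  near=> s; apply: fE.
  suff : s \in `]-oo, 1[ by rewrite in_itv.
  by near: s; apply: near_in_itvNyo; rewrite in_itv.
rewrite /prop_for /continuous_at -fE//; apply: cvg_trans (near_eq_cvg near1) _.
apply: cvgB; first exact: cvg_cst.
apply: continuous_comp; last exact: continuous_expR.
apply: cvgN; apply: cvgM; first exact: cvg_cst.
apply: (@continuous_comp _ _ _ (fun s : R => s / (1 - s))
  (fun x : R => Num.max x 0 `^ b)); last exact: maxr0_powR_continuous.
apply: cvgM; first exact: cvg_id.
apply: cvgV; first by rewrite subr_eq0 gt_eqF.
by apply: cvgB; [exact: cvg_cst|exact: cvg_id].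
Unshelve. all: by end_near. Qed.

Lemma kies_cdf_ge0_le1 (R : realType) (l b t : R) :
  0 <= l -> 0 <= kies_cdf l b t <= 1.
Proof.
move=> l0; rewrite /kies_cdf; case: ifP => _; first by rewrite lexx ler01.
case: ifP => _; last by rewrite ler01 lexx.
by rewrite subr_ge0 expR_le1 oppr_le0 mulr_ge0 ?powR_ge0//= gerBl expR_ge0.
Qed.

Lemma kies_cdf_nd (R : realType) (l b : R) :
  0 <= l -> 0 <= b -> {homo kies_cdf l b : s t / s <= t}.
Proof.
move=> l0 b0 s t st.
have [s0|s0] := ltP s 0.
  by rewrite {1}/kies_cdf s0; case/andP: (kies_cdf_ge0_le1 _ l b t l0).
have [t1|t1] := ltP t 1; last first.
  rewrite [leRHS]/kies_cdf !ltNge t1 (le_trans s0 st)/=.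
  by case/andP: (kies_cdf_ge0_le1 _ l b s l0).
have s1 := le_lt_trans st t1; have t0 := le_trans s0 st.
rewrite /kies_cdf t1 s1 !ltNge t0 s0/= lerB// ler_expR lerN2.
rewrite ler_wpM2l// ge0_ler_powR// ?nnegrE ?divr_ge0 ?subr_ge0 ?(ltW s1)
  ?(ltW t1)//.
(* Cross-multiplied, the monotonicity of [t / (1 - t)] reads [s * (1 - t) <= t * (1 - s)]. *)
rewrite ler_pdivrMr ?subr_gt0// mulrAC ler_pdivlMr ?subr_gt0//; nra.
Qed.

Lemma kies_cdf0 (R : realType) (l b : R) : b != 0 -> kies_cdf l b 0 = 0.
Proof.
move=> b0; rewrite /kies_cdf ltxx ltr01 mul0r powR0//.
by rewrite mulr0 oppr0 expR0 subrr.
Qed.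

Lemma kies_cdf1 (R : realType) (l b : R) : kies_cdf l b 1 = 1.
Proof. by rewrite /kies_cdf ltxx ltr10. Qed.

(** The base [1 / d - 1] is the inverse of [d / (1 - d)], so the two powers of exponent [b] cancel
    and only [tau] remains in the exponential. *)
Lemma kies_cdf_fixpoint (R : realType) (tau b d : R) : 0 < d < 1 ->
  kies_cdf (tau * (1 / d - 1) `^ b) b d = 1 - expR (- tau).
Proof.
move=> /andP[d0 d1]; rewrite /kies_cdf ltNge ltW//= d1 -mulrA -powRM.
- have -> : (1 / d - 1) * (d / (1 - d)) = 1.
    by field; rewrite (gt_eqF d0)/= subr_eq0 gt_eqF.
  by rewrite powR1 mulr1.
- by rewrite subr_ge0 ler_pdivlMr// mul1r ltW.
- by rewrite divr_ge0 ?subr_ge0// ltW.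
Qed.

(** * Measurability and expectations *)

Lemma measurable_kies_cdf (R : realType) (disp : measure_display)
    (T : measurableType disp) (l b : T -> R) (t : R) :
  measurable_fun setT l -> measurable_fun setT b ->
  measurable_fun setT (fun w => kies_cdf (l w) (b w) t).
Proof.
move=> ml mb; rewrite /kies_cdf.
case: (t < 0); first exact: measurable_cst.
case: (t < 1); last exact: measurable_cst.
apply: measurable_funB; first exact: measurable_cst.
apply: measurableT_comp; first exact: measurable_expR.
apply: measurableT_comp; first exact: oppr_measurable.
apply: measurable_funM => //.
exact: measurableT_comp (measurable_powRr _) mb.
Qed.

(** If the expectation vanished, [X] would be 0 almost everywhere. Since it is 0 nowhere, the whole
    space would then be a null set. *)
Lemma expectation_gt0 (R : realType) (disp : measure_display)
    (T : measurableType disp) (P : probability T R) (X : T -> R) :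
  measurable_fun setT X -> (forall w, 0 < X w) -> (0 < 'E_P[X])%E.
Proof.
move=> mX X0.
rewrite lt_neqAle expectation_ge0 ?andbT; last by move=> w; exact: ltW.
apply/eqP => EX; have : ae_eq P setT (EFin \o X) (cst 0%E).
  apply/ae_eq_integral_abs => //; first exact/measurable_EFinP.
  rewrite [RHS]EX unlock; apply: eq_integral => w _.
  by rewrite /= ger0_norm// ltW.
case=> N [mN N0 subN]; have : P setT = 0%E.
  apply/eqP; rewrite -measure_le0 -N0; apply: le_measure; rewrite ?inE//.
  by move=> w _; apply: subN => /(_ I)/= [] /eqP; rewrite gt_eqF.
by rewrite probability_setT => /eqP; rewrite eqe oner_eq0.
Qed.

Lemma ae_eq_expectation (R : realType) (disp : measure_display)
    (T : measurableType disp) (P : probability T R) (X Y : T -> R) :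
  measurable_fun setT X -> measurable_fun setT Y ->
  {ae P, forall w, X w = Y w} -> ('E_P[X] = 'E_P[Y])%E.
Proof.
move=> mX mY XY; rewrite unlock; apply: ae_eq_integral => //;
  [exact/measurable_EFinP|exact/measurable_EFinP|].
by apply: filterS XY => w -> _.
Qed.

(** * The mixture CDF as an integral of Kies CDFs *)

Section kies_mixture.
Context (R : realType) (disp : measure_display) (Omega : measurableType disp).
Context (P : probability Omega R) (l b : Omega -> R).
Context (ml : measurable_fun setT l) (mb : measurable_fun setT b).
Context (l0 : forall w, 0 < l w) (b0 : forall w, 0 < b w).

Local Notation F := (kies_mixture_cdf P l b).

Lemma kies_mixture_cdfE t : F t = (\int[P]_w kies_cdf (l w) (b w) t)%R.
Proof. by rewrite /kies_mixture_cdf unlock. Qed.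

Lemma integrable_kies_cdf t :
  P.-integrable setT (EFin \o (fun w => kies_cdf (l w) (b w) t)).
Proof.
apply: (@le_integrable _ _ _ _ _ measurableT _ (EFin \o cst 1)).
- exact/measurable_EFinP/measurable_kies_cdf.
- move=> w _ /=; have /andP[h0 h1] := kies_cdf_ge0_le1 _ _ (b w) t (ltW (l0 w)).
  by rewrite lee_fin normr1 ger0_norm.
- exact: finite_measure_integrable_cst.
Qed.

Lemma kies_mixture_cdf_nd : {homo F : s t / s <= t}.
Proof.
move=> s t st; rewrite !kies_mixture_cdfE; apply: le_Rintegral.
- exact: measurableT.
- exact: integrable_kies_cdf.
- exact: integrable_kies_cdf.
- by move=> w _; apply: kies_cdf_nd st; exact: ltW.
Qed.

Lemma kies_mixture_cdf0 : F 0 = 0.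
Proof.
rewrite /kies_mixture_cdf (_ : (fun _ => _) = cst 0) ?expectation_cst//.
by apply/funext => w; rewrite kies_cdf0// gt_eqF.
Qed.

Lemma kies_mixture_cdf1 : F 1 = 1.
Proof.
rewrite /kies_mixture_cdf (_ : (fun _ => _) = cst 1) ?expectation_cst//.
by apply/funext => w; rewrite kies_cdf1.
Qed.

(** Continuity passes under the integral by domination with the constant 1. The left end [-1] puts 0
    inside the open interval, and the right end excludes 1. *)
Lemma kies_mixture_cdf_continuous : {in `]-1, 1[, continuous F}.
Proof.
have -> : F = fun t => (\int[P]_w kies_cdf (l w) (b w) t)%R.
  by apply/funext => t; rewrite kies_mixture_cdfE.
move=> t t11.
apply: (@continuity_under_integral _ _ _ _ (fun t w => kies_cdf (l w) (b w) t)
  setT measurableT (-1) 1 _ _ (cst 1)).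
- by move=> s _; exact: integrable_kies_cdf.
- apply: aeW => w _ s; rewrite inE/= in_itv/= => /andP[_ s1].
  exact: kies_cdf_continuous.
- exact: finite_measure_integrable_cst.
- move=> s _; apply: aeW => w _.
  have /andP[h0 h1] := kies_cdf_ge0_le1 _ _ (b w) s (ltW (l0 w)).
  by rewrite ger0_norm.
- by rewrite inE.
Qed.

Lemma saturation_kies_mixture d :
  0 < d < 1 -> F d = 1 - d -> saturation F = d%:E.
Proof.
move=> /andP[d0 d1] Fd; apply: saturation_eq.
- by rewrite !ltW.
- by move=> s t _ _; exact: kies_mixture_cdf_nd.
- exact: kies_mixture_cdf0.
- exact: kies_mixture_cdf1.
- exact: Fd.
- apply: continuous_in_subspaceT => t; rewrite inE/= in_itv/= => /andP[t0 td].
  apply: kies_mixture_cdf_continuous; rewrite in_itv/= (le_lt_trans td)// andbT.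
  by rewrite (lt_le_trans _ t0)// ltrN10.
Qed.

End kies_mixture.

(** * Saturation when [lambda] is expressed through [tau] *)

Lemma integrable_expRN (R : realType) (disp : measure_display)
    (T : measurableType disp) (P : probability T R) (X : T -> R) :
  measurable_fun setT X -> (forall w, 0 <= X w) ->
  P.-integrable setT (EFin \o (fun w => expR (- X w))).
Proof.
move=> mX X0; apply: (@le_integrable _ _ _ _ _ measurableT _ (EFin \o cst 1)).
- apply/measurable_EFinP; apply: measurableT_comp => //.
  exact: measurableT_comp.
- move=> w _ /=; rewrite lee_fin normr1 ger0_norm ?expR_ge0//.
  by rewrite expR_le1 oppr_le0.
- exact: finite_measure_integrable_cst.
Qed.

(** This is the case where positivity and the formula for [lambda] hold at every point. There
    [kies_cdf_fixpoint] applies pointwise and integrates to the mixture having value [1 - d] at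
    [d]. *)
Lemma saturation_kies_mixture_pos (R : realType) (disp : measure_display)
    (Omega : measurableType disp) (P : probability Omega R)
    (beta tau : Omega -> R) (d : R) :
  measurable_fun setT beta -> measurable_fun setT tau ->
  (forall w, 0 < beta w) -> (forall w, 0 < tau w) ->
  ('E_P[fun w => expR (- tau w)%R])%E = d%:E ->
  saturation (kies_mixture_cdf P
    (fun w => tau w * (1 / d - 1) `^ beta w) beta) = d%:E.
Proof.
move=> mbeta mtau beta0 tau0 Ed.
have mexp : measurable_fun setT (fun w => expR (- tau w)).
  by apply: measurableT_comp => //; exact: measurableT_comp.
have iexp : P.-integrable setT (EFin \o (fun w => expR (- tau w))).
  by apply: integrable_expRN => // w; exact: ltW.
(* This identity serves twice: a positive integrand gives [d < 1], and the integrand is the Kies CDF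
   at [d]. *)
have EB : ('E_P[fun w => (1 - expR (- tau w))%R] = (1 - d)%:E)%E.
  rewrite (_ : (fun _ => _) = cst 1 \- (fun w => expR (- tau w)))//.
  rewrite expectationB.
  - by rewrite expectation_cst Ed.
  - by apply/Lfun1_integrable; exact: finite_measure_integrable_cst.
  - exact/Lfun1_integrable.
have d0 : 0 < d.
  by rewrite -lte_fin -Ed; apply: expectation_gt0 => // w; exact: expR_gt0.
have d1 : d < 1.
  rewrite -subr_gt0 -lte_fin -EB; apply: expectation_gt0.
    by apply: measurable_funB => //; exact: measurable_cst.
  by move=> w; rewrite subr_gt0 expR_lt1 oppr_lt0.
apply: saturation_kies_mixture => //.
- apply: measurable_funM => //.
  exact: measurableT_comp (measurable_powRr _) mbeta.
- by move=> w; rewrite mulr_gt0// powR_gt0// subr_gt0 ltr_pdivlMr// mul1r.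
- by rewrite d0.
- rewrite /kies_mixture_cdf -[RHS]/(fine (1 - d)%:E) -EB.
  congr (fine 'E_P[_]%E).
  by apply/funext => w; rewrite kies_cdf_fixpoint// d0.
Qed.

Theorem theorem4p4 (R : realType) (disp : measure_display)
    (Omega : measurableType disp) (P : probability Omega R)
    (lambda beta tau : {RV P >-> R})
    (lambda_gt0 : {ae P, forall w, 0 < lambda w})
    (beta_gt0 : {ae P, forall w, 0 < beta w})
    (tau_gt0 : {ae P, forall w, 0 < tau w})
    (moment1 : ('E_P[fun w => (beta w / lambda w `^ (1 / beta w)
        * ((beta w + 1) / beta w) `^ ((beta w + 1) / beta w))%R] < +oo)%E)
    (moment2 : ('E_P[lambda] < +oo)%E)
    (moment3 : ('E_P[fun w => (lambda w * beta w)%R] < +oo)%E)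
    (lambdaE : {ae P, forall w, lambda w =
      tau w * (1 / fine 'E_P[fun w' => expR (- tau w')] - 1) `^ beta w}) :
  saturation (kies_mixture_cdf P lambda beta)
    = ('E_P[fun w => expR (- tau w)%R])%E.
Proof.
(* Changing the variables on a null set makes them positive everywhere. *)
pose pos (X : Omega -> R) w := if 0 < X w then X w else 1.
have pos0 X w : 0 < pos X w by rewrite /pos; case: ifP.
have mpos X : measurable_fun setT X -> measurable_fun setT (pos X).
  move=> mX; apply: measurable_fun_ifT => //.
  by apply: measurable_fun_ltr => //; exact: measurable_cst.
have mexp (X : Omega -> R) :
    measurable_fun setT X -> measurable_fun setT (fun w => expR (- X w)).
  by move=> mX; apply: measurableT_comp => //; exact: measurableT_comp.
have mbeta := mpos _ (@measurable_funPT _ _ _ _ beta).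
have mtau := mpos _ (@measurable_funPT _ _ _ _ tau).
have Etau : ('E_P[fun w => expR (- tau w)%R]
    = 'E_P[fun w => expR (- pos tau w)%R])%E.
  apply: ae_eq_expectation; [exact: mexp|exact: mexp|].
  by apply: filterS tau_gt0 => w; rewrite /pos => ->.
(* As [fine] sends infinite values to 0, finiteness is what makes the real number [d] equal to the
   expectation. *)
have Efin : ('E_P[fun w => expR (- pos tau w)%R] \is a fin_num)%E.
  apply/expectation_fin_num/Lfun1_integrable.
  by apply: integrable_expRN => // w; exact: ltW.
rewrite Etau in lambdaE *; set d := fine _ in lambdaE.
(* For each [t] the mixture CDF is an expectation, hence insensitive to changes on a null set. This
   also lets the almost sure formula replace [lambda]. *)
have -> : kies_mixture_cdf P lambda beta =
    kies_mixture_cdf P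
      (fun w => pos tau w * (1 / d - 1) `^ pos beta w) (pos beta).
  apply/funext => t; apply: (congr1 fine).
  apply: ae_eq_expectation.
  - by apply: measurable_kies_cdf; exact: measurable_funPT.
  - apply: (measurable_kies_cdf _ _ _ _ _ _ _ mbeta).
    apply: measurable_funM; first exact: mtau.
    exact: measurableT_comp (measurable_powRr _) mbeta.
  - move: beta_gt0 tau_gt0 lambdaE; apply: filterS3 => w bw tw ->.
    by rewrite /pos bw tw.
have Ed : ('E_P[fun w => expR (- pos tau w)%R])%E = d%:E by rewrite fineK.
rewrite Ed; exact: saturation_kies_mixture_pos Ed.
Qed.
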